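(* Let $x,y$ be real numbers with $x+y\neq 0$ and $\frac{x}{x+y}\geq 0$, and let $n,p\in\mathbb{N}=\{1,2,3,\ldots\}$. Then $$\sum_{k=0}^n x^k y^{n-k}\binom{n}{k} Y_p(k)=(-1)^{p-1}\,p!\,(x+y)^n \sum_{j=1}^n \left(1-\Big(\frac{y}{x+y}\Big)^j\right)\sum_{i=0}^{p-1} (-1)^i\, \frac{Y_i(n)}{i!}\, \frac{s(j,p-i)}{j!},$$ where $s(j,k)$ are the unsigned Stirling numbers of the first kind and $Y_i(n)$ are the Bell numbers defined in the context.
   Context: Conventions: $\mathbb{N}=\{1,2,3,\ldots\}$, and $0^0=1$ in the binomial-type sum. Generalized harmonic numbers: $H_n^{(m)}=\sum_{j=1}^n \frac{1}{j^m}$ for $n\geq 0$, $m\geq 1$ (so $H_0^{(m)}=0$), and $H_n=H_n^{(1)}$. Unsigned Stirling numbers of the first kind $s(n,k)$: defined by $n!\,t(1+t)\left(1+\frac t2\right)\cdots\left(1+\frac tn\right)=\sum_{k=0}^n s(n+1,k+1)t^{k+1}$, with $s(n,k)=0$ if $n<k$, $s(n,0)=s(0,k)=0$ for $n,k\ge 1$, and $s(0,0)=1$. They satisfy $s(n,k)=s(n-1,k-1)+(n-1)s(n-1,k)$ for $n,k\in\mathbb{N}$. Complete exponential Bell polynomials: $Y_0=1$ and, for $m\geq 1$, $Y_m(x_1,\ldots,x_m)=\sum_{j=0}^{m-1}\binom{m-1}{j}x_{m-j}Y_j(x_1,\ldots,x_j)$. ''Bell numbers'' (in the sense used here): for $m,n\geq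 0$, $Y_m(n):=Y_m\big(H_n,\,1!\,H_n^{(2)},\,2!\,H_n^{(3)},\ldots,(m-1)!\,H_n^{(m)}\big)$; e.g. $Y_0(n)=1$, $Y_1(n)=H_n$, $Y_2(n)=H_n^2+H_n^{(2)}$. *)

(* Defs.v *)
From mathcomp Require Import all_boot all_order all_algebra.
From mathcomp Require Import reals.

Set Implicit Arguments.
Unset Strict Implicit.
Unset Printing Implicit Defensive.

Import Order.TTheory GRing.Theory Num.Theory.
Local Open Scope ring_scope.

(* H_n^(m) *)
Definition gharmonic (R : realType) (n m : nat) : R :=
  \sum_(1 <= j < n.+1) (j%:R ^+ m)^-1.

(* n! t (1 + t) (1 + t/2) ... (1 + t/n) *)
Definition stirling_poly (R : realType) (n : nat) : {poly R} :=
  n`!%:R *: ('X * \prod_(1 <= i < n.+1) (1 + i%:R^-1 *: 'X)).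

(* Unsigned Stirling numbers of the first kind, as elements of R: s(n+1, k) is
   the coefficient of t^k in stirling_poly n. This already gives s(n+1, 0) = 0
   and s(n, k) = 0 for n < k. *)
Definition stirling1 (R : realType) (n k : nat) : R :=
  if n is n'.+1 then (stirling_poly R n')`_k else (k == 0%N)%:R.

(* [:: Y_0; ...; Y_m] for the complete exponential Bell polynomials evaluated
   at x_i = x i, i >= 1 (x 0 is never used); see bellYS for the recurrence. *)
Fixpoint bellY_seq (R : realType) (x : nat -> R) (m : nat) : seq R :=
  if m is m'.+1 then
    let s := bellY_seq x m' in
    rcons s (\sum_(0 <= j < m) 'C(m', j)%:R * x (m - j)%N * s`_j)
  else [:: 1].

Definition bellY (R : realType) (x : nat -> R) (m : nat) : R :=
  (bellY_seq x m)`_m.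

(* Y_m(n) *)
Definition bell_number (R : realType) (m n : nat) : R :=
  bellY (fun i => (i - 1)`!%:R * gharmonic R n i) m.

Lemma size_bellY_seq (R : realType) (x : nat -> R) m :
  size (bellY_seq x m) = m.+1.
Proof. by elim: m => //= m IHm; rewrite size_rcons IHm. Qed.

Lemma nth_bellY_seq (R : realType) (x : nat -> R) m j :
  (j <= m)%N -> (bellY_seq x m)`_j = bellY x j.
Proof.
elim: m => [|m IHm]; first by rewrite leqn0 => /eqP ->.
rewrite leq_eqVlt => /predU1P[-> //|]; rewrite ltnS => le_jm.
by rewrite /= nth_rcons size_bellY_seq ltnS le_jm IHm.
Qed.

Lemma bellY0 (R : realType) (x : nat -> R) : bellY x 0 = 1.
Proof. by []. Qed.

Lemma bellYS (R : realType) (x : nat -> R) m : (0 < m)%N ->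
  bellY x m = \sum_(0 <= j < m) 'C(m - 1, j)%:R * x (m - j)%N * bellY x j.
Proof.
case: m => // m _; rewrite {1}/bellY /= nth_rcons size_bellY_seq ltnn eqxx.
rewrite subn1 /=; apply: eq_big_nat => j /andP[_]; rewrite ltnS => le_jm.
by rewrite nth_bellY_seq.
Qed.

Lemma bell_number1 (R : realType) n : bell_number R 1 n = gharmonic R n 1.
Proof. by rewrite /bell_number bellYS // big_nat1 bellY0 !mul1r mulr1. Qed.

Lemma bell_number2 (R : realType) n :
  bell_number R 2 n = gharmonic R n 1 ^+ 2 + gharmonic R n 2.
Proof.
rewrite /bell_number bellYS // big_nat_recr //= big_nat1 bellY0 mulr1.
by rewrite -/(bell_number R 1 n) bell_number1 !mul1r addrC expr2.
Qed.

Lemma size_stirling_poly (R : realType) n :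
  (size (stirling_poly R n) <= n.+2)%N.
Proof.
rewrite (leq_trans (size_scale_leq _ _)) // mulrC.
rewrite (leq_trans (size_polyMleq _ _)) // size_polyX addn2 /= ltnS.
elim: n => [|n IHn]; first by rewrite big_nil size_poly1.
rewrite big_nat_recr //= (leq_trans (size_polyMleq _ _)) //.
rewrite -subn1 leq_subLR add1n -[n.+3]addn2 leq_add //.
rewrite (leq_trans (size_polyD _ _)) // geq_max size_poly1 /=.
by rewrite (leq_trans (size_scale_leq _ _)) // size_polyX.
Qed.

Lemma stirling1E (R : realType) n (t : R) :
  n`!%:R * t * \prod_(1 <= i < n.+1) (1 + t / i%:R) =
  \sum_(0 <= k < n.+1) stirling1 R n.+1 k.+1 * t ^+ k.+1.
Proof.
transitivity (stirling_poly R n).[t].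
  rewrite hornerZ hornerM hornerX horner_prod mulrA; congr (_ * _).
  by apply: eq_bigr => i _; rewrite hornerD hornerZ hornerC hornerX mulrC.
rewrite (horner_coef_wide _ (size_stirling_poly R n)) big_ord_recl /=.
by rewrite coefZ coefXM /= mulr0 mul0r add0r big_mkord.
Qed.

Lemma stirling1_small (R : realType) n k : (n < k)%N -> stirling1 R n k = 0.
Proof.
case: n k => [[]//|n] k lt_nk.
by rewrite /stirling1 nth_default // (leq_trans (size_stirling_poly R n)).
Qed.

Lemma stirling1n0 (R : realType) n : (0 < n)%N -> stirling1 R n 0 = 0.
Proof. by case: n => // n _; rewrite /stirling1 coefZ coefXM mulr0. Qed.

Lemma stirling1S (R : realType) n k : (0 < n)%N -> (0 < k)%N ->
  stirling1 R n k =
  stirling1 R (n - 1) (k - 1) + (n - 1)%:R * stirling1 R (n - 1) k.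
Proof.
case: n k => [|[|n]] [|k] // _ _; rewrite !subSS !subn0 /=.
  by rewrite mul0r addr0 /stirling_poly big_nil mulr1 scale1r coefX eqSS.
suff ->: stirling_poly R n.+1 =
    'X * stirling_poly R n + n.+1%:R *: stirling_poly R n.
  by rewrite coefD coefXM coefZ.
rewrite /stirling_poly big_nat_recr //= factS natrM -scalerA.
set P := \prod_(_ <= _ < _) _.
rewrite mulrA mulrDr mulr1 2!scalerDr addrC; congr (_ + _).
rewrite -!scalerAr !scalerA mulrAC divff ?pnatr_eq0 // mul1r.
by rewrite mulrC.
Qed.

(* Main.v *)
Require Import Defs.
From mathcomp Require Import all_boot all_order all_algebra.
From mathcomp Require Import reals.
From mathcomp Require Import ring.

Set Implicit Arguments.
Unset Strict Implicit.
Unset Printing Implicit Defensive.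

Import Order.TTheory GRing.Theory Num.Theory.
Local Open Scope ring_scope.

(** By Newton's identities, [Y_p(k) / p!] is the complete homogeneous symmetric
    polynomial of degree p in 1, 1/2, ..., 1/k, that is, the coefficient of t^p
    in [1 / Q_k], where [Q_k = (1 - t) (1 - t/2) ... (1 - t/k)]. Multiplied by
    [Q_n], the generating function in p of the left-hand side becomes the
    polynomial
      [B_n = \sum_k C(n, k) x^k y^(n-k) Q_n / Q_k].
    Here [C(n, k) Q_n / Q_k] is the generalized binomial coefficient
    [C(n - t, n - k)], so Pascal's rule gives
      [B_(n+1) = (x + y) B_n - y^(n+1) D_(n+1)],  [D_j = Q_(j-1) - Q_j],
    where the correction comes from k = 0. Hence, with [mu = y / (x + y)],
      [B_n = (x + y)^n (1 - \sum_j mu^j D_j)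
           = (x + y)^n (Q_n + \sum_j (1 - mu^j) D_j)],
    because the [D_j] telescope to [1 - Q_n]. Dividing by [Q_n] turns the term
    [Q_n] into the constant 1, which is invisible in degree p > 0; and
    [D_j = t (1 - t) ... (j - 1 - t) / j!] has as coefficients the signed
    Stirling numbers divided by j!.

    Division by [Q_n] is only needed on a single coefficient, so no power
    series are used: [inv_coef n p q] is the coefficient of t^p in [q / Q_n],
    computed by convolution with the numbers [Y_i(n) / i!], and all that is
    used of it is linearity and [inv_coef_tail], the cancellation of the
    factors of [Q_n]. *)

(** * Bell numbers as complete homogeneous sums *)

Definition nbell (R : realType) (p k : nat) : R := bell_number R p k / p`!%:R.

Lemma nbell0 (R : realType) k : nbell R 0 k = 1.
Proof. by rewrite /nbell divr1. Qed.

(** Newton's identity: the factorials in the recurrence of the Bell polynomials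
    cancel those of the normalization and of the arguments (i - 1)! H^(i). *)
Lemma nbell_newton (R : realType) p k :
  p%:R * nbell R p k = \sum_(j < p) gharmonic R k (p - j) * nbell R j k.
Proof.
case: p => [|p]; first by rewrite big_ord0 mul0r.
rewrite /nbell {1}/bell_number bellYS // big_mkord subn1 /= mulr_suml mulr_sumr.
apply: eq_bigr => j _; rewrite -/(bell_number R j k).
have -> : (p.+1 - j - 1 = p - j)%N by rewrite subnAC subn1.
rewrite factS -(bin_fact (leq_ord j)) !natrM.
have Cn0 : 'C(p, j)%:R != 0 :> R by rewrite pnatr_eq0 -lt0n bin_gt0 leq_ord.
have fn0 i : i`!%:R != 0 :> R by rewrite pnatr_eq0 -lt0n fact_gt0.
have : p.+1%:R != 0 :> R by rewrite pnatr_eq0.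
move: (p.+1%:R : R) => c c_n0; field.
by rewrite c_n0 Cn0 !fn0.
Qed.

Lemma gharmonicS (R : realType) k m :
  gharmonic R k.+1 m = gharmonic R k m + k.+1%:R^-1 ^+ m.
Proof. by rewrite /gharmonic big_nat_recr //= exprVn. Qed.

Lemma nbell_at0 (R : realType) p : nbell R p 0 = (p == 0)%:R.
Proof.
case: p => [|p]; first exact: nbell0.
have nz : p.+1%:R != 0 :> R by rewrite pnatr_eq0.
apply: (mulfI nz); rewrite nbell_newton mulr0 big1 // => j _.
by rewrite /gharmonic big_geq ?mul0r.
Qed.

(** The rule [h_p(u_1 .. u_(k+1)) = h_p(u_1 .. u_k) + u_(k+1) h_(p-1)(u_1 .. u_(k+1))]
    of complete homogeneous sums, extracted from Newton's identity by strong
    induction on p. *)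
Lemma nbellS (R : realType) p k :
  nbell R p.+1 k.+1 = nbell R p.+1 k + k.+1%:R^-1 * nbell R p k.+1.
Proof.
elim/ltn_ind: p => p IHp; set u := k.+1%:R^-1 in IHp *.
have nz m : m.+1%:R != 0 :> R by rewrite pnatr_eq0.
apply: (mulfI (nz p)); rewrite nbell_newton.
have splitH m f : \sum_(j < m) gharmonic R k.+1 (m - j) * f j =
    \sum_(j < m) gharmonic R k (m - j) * f j + \sum_(j < m) u ^+ (m - j) * f j.
  by rewrite -big_split; apply: eq_bigr => j _; rewrite gharmonicS mulrDl.
rewrite (splitH _ (fun j => nbell R j k.+1)).
(* The induction hypothesis turns the H(k) part into p+1 times the first term
   plus u times the same sum for p; the latter recombines with the powers of u
   into Newton's sum for p. *)
have -> : \sum_(j < p.+1) gharmonic R k (p.+1 - j) * nbell R j k.+1 =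
    p.+1%:R * nbell R p.+1 k +
    u * \sum_(j < p) gharmonic R k (p - j) * nbell R j k.+1.
  rewrite nbell_newton !big_ord_recl !nbell0 -addrA; congr (_ + _).
  rewrite mulr_sumr -big_split; apply: eq_bigr => j _ /=.
  by rewrite /bump add1n subSS IHp //; ring.
have -> : \sum_(j < p.+1) u ^+ (p.+1 - j) * nbell R j k.+1 =
    u * nbell R p k.+1 + u * \sum_(j < p) u ^+ (p - j) * nbell R j k.+1.
  rewrite big_ord_recr /= subSnn expr1 addrC mulr_sumr; congr (_ + _).
  by apply: eq_bigr => j _; rewrite subSn ?exprS ?mulrA // ltnW.
rewrite addrACA -mulrDr -(splitH p (fun j => nbell R j k.+1)) -nbell_newton.
by rewrite -natr1; ring.
Qed.

(** * The polynomials (1 - t/(k+1)) ... (1 - t/n) *)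

(** For [k <= n] this is [Q_n / Q_k]. *)
Definition harm_poly (R : realType) (k n : nat) : {poly R} :=
  \prod_(k <= i < n) (1 - i.+1%:R^-1 *: 'X).

Lemma harm_polyS (R : realType) k n : (k <= n)%N ->
  harm_poly R k n.+1 = (1 - n.+1%:R^-1 *: 'X) * harm_poly R k n.
Proof. by move=> le_kn; rewrite /harm_poly big_nat_recr //= mulrC. Qed.

Lemma harm_poly_cons (R : realType) k n : (k < n)%N ->
  harm_poly R k n = (1 - k.+1%:R^-1 *: 'X) * harm_poly R k.+1 n.
Proof. by move=> lt_kn; rewrite /harm_poly big_ltn. Qed.

Lemma harm_poly_id (R : realType) n : harm_poly R n n = 1.
Proof. by rewrite /harm_poly big_geq. Qed.

(** * Coefficients of q / Q_n *)

(** The coefficient of t^p in the power series [q / Q_n], where [nbell R i n] is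
    the coefficient of t^i in [1 / Q_n]. *)
Definition inv_coef (R : realType) (n p : nat) (q : {poly R}) : R :=
  \sum_(i < p.+1) nbell R i n * q`_(p - i).

(** Truncating [1 / Q_n] at degree p makes [inv_coef] a coefficient of a product
    of polynomials, from which its linearity is inherited. *)
Lemma inv_coefM (R : realType) n p (q : {poly R}) :
  inv_coef n p q = ((\poly_(i < p.+1) nbell R i n) * q)`_p.
Proof. by rewrite coefM; apply: eq_bigr => i _; rewrite coef_poly ltn_ord. Qed.

Lemma inv_coef_sum (R : realType) n p m1 m2 (c : nat -> R)
    (q : nat -> {poly R}) :
  inv_coef n p (\sum_(m1 <= i < m2) c i *: q i) =
  \sum_(m1 <= i < m2) c i * inv_coef n p (q i).
Proof.
rewrite inv_coefM mulr_sumr coef_sum; apply: eq_bigr => i _.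
by rewrite -scalerAr coefZ inv_coefM.
Qed.

Lemma inv_coefD (R : realType) n p (q r : {poly R}) :
  inv_coef n p (q + r) = inv_coef n p q + inv_coef n p r.
Proof. by rewrite !inv_coefM mulrDr coefD. Qed.

Lemma inv_coefZ (R : realType) n p c (q : {poly R}) :
  inv_coef n p (c *: q) = c * inv_coef n p q.
Proof. by rewrite !inv_coefM -scalerAr coefZ. Qed.

(** Up to degree p, multiplying the truncated series [1 / Q_(n+1)] by its last
    factor gives [1 / Q_n]: this is [nbellS] read as a relation between series. *)
Lemma inv_coef_factor (R : realType) n p (q : {poly R}) :
  inv_coef n.+1 p ((1 - n.+1%:R^-1 *: 'X) * q) = inv_coef n p q.
Proof.
rewrite !inv_coefM mulrA !coefM; apply: eq_bigr => -[i le_ip] _ /=.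
congr (_ * _); rewrite mulrBr mulr1 -scalerAr coefB coefZ coefMX !coef_poly.
rewrite le_ip; case: i le_ip => [|i] le_ip; first by rewrite mulr0 subr0 !nbell0.
by rewrite /= ltnW // nbellS addrK.
Qed.

(** [(Q_n / Q_k) / Q_n = 1 / Q_k]. *)
Lemma inv_coef_tail (R : realType) k n p : (k <= n)%N ->
  inv_coef n p (harm_poly R k n) = nbell R p k.
Proof.
move/subnKC <-; elim: (n - k)%N => [|m IHm].
  rewrite addn0 harm_poly_id /inv_coef big_ord_recr /= subnn coef1 mulr1.
  by rewrite big1 ?add0r // => i _; rewrite coef1 subn_eq0 leqNgt ltn_ord mulr0.
by rewrite addnS harm_polyS ?leq_addr // inv_coef_factor.
Qed.

(** * The terms Q_(j-1) - Q_j *)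

(** For j > 0 this is [D_j = t (1 - t) ... (j - 1 - t) / j!]. *)
Definition stirling_term (R : realType) (j : nat) : {poly R} :=
  j%:R^-1 *: ('X * harm_poly R 0 j.-1).

Lemma harm_poly_sub (R : realType) n :
  harm_poly R 0 n.+1 = harm_poly R 0 n - stirling_term R n.+1.
Proof. by rewrite harm_polyS // mulrBl mul1r -scalerAl. Qed.

Lemma sum_stirling_term (R : realType) n :
  \sum_(1 <= j < n.+1) stirling_term R j = 1 - harm_poly R 0 n.
Proof.
elim: n => [|n IHn]; first by rewrite big_geq // harm_poly_id subrr.
by rewrite big_nat_recr //= IHn harm_poly_sub opprB addrA addrAC.
Qed.

(** [Q_n] is the product defining the Stirling numbers with -t in place of t. *)
Lemma coef_harm_poly (R : realType) n m :
  (harm_poly R 0 n)`_m =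
  (-1) ^+ m * (\prod_(1 <= i < n.+1) (1 + i%:R^-1 *: 'X) : {poly R})`_m.
Proof.
elim: n m => [|n IHn] m.
  rewrite harm_poly_id big_nil coef1.
  by case: m => [|m]; rewrite ?expr0 ?mul1r ?mulr0.
rewrite harm_polyS // mulrC big_nat_recr //= mulrBr mulrDr !mulr1 -!scalerAr.
rewrite coefB coefD !coefZ !coefMX; case: m => [|m] /=.
  by rewrite !mulr0 subr0 addr0 IHn.
by rewrite !IHn exprS; ring.
Qed.

Lemma coef_stirling_term (R : realType) j m : (0 < j)%N -> (0 < m)%N ->
  (stirling_term R j)`_m = (-1) ^+ (m - 1) * (stirling1 R j m / j`!%:R).
Proof.
case: j m => [|j] [|m] // _ _; rewrite /stirling1 /stirling_poly /stirling_term.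
rewrite !coefZ !coefXM /= coef_harm_poly subn1 /= factS natrM.
set c := (_ : {poly R})`_m.
have fj : j`!%:R != 0 :> R by rewrite pnatr_eq0 -lt0n fact_gt0.
have : j.+1%:R != 0 :> R by rewrite pnatr_eq0.
move: (j.+1%:R : R) => d d_n0; field.
by rewrite d_n0 fj.
Qed.

Lemma coef0_stirling_term (R : realType) j : (stirling_term R j)`_0 = 0.
Proof. by rewrite coefZ coefXM mulr0. Qed.

(** * The binomial sum of the quotients Q_n / Q_k *)

(** Pascal's rule
    [binom(n+1-t, n-k) = binom(n-t, n-k-1) + binom(n-t, n-k)].
    After division by the common factor [Q_n / Q_(k+1)], both sides are of degree
    1 in t: the constant terms agree by the integral Pascal rule, the
    coefficients of t by [(k+1) C(n+1, k+1) = (n+1) C(n, k)]. *)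
Lemma harm_pascal (R : realType) k n : (k <= n)%N ->
  'C(n.+1, k.+1)%:R *: harm_poly R k.+1 n.+1 =
  'C(n, k.+1)%:R *: harm_poly R k.+1 n + 'C(n, k)%:R *: harm_poly R k n.
Proof.
rewrite leq_eqVlt => /predU1P[->|lt_kn].
  by rewrite !harm_poly_id !binn bin_small // scale0r add0r.
rewrite harm_polyS // (harm_poly_cons _ lt_kn) -!mul_polyC !mulrA -mulrDl.
congr (_ * _); rewrite !mulrBr !mulr1 !mul_polyC !scalerA addrA.
rewrite -polyCD -natrD -binS; congr (_ - _ *: _).
have nz m : m.+1%:R != 0 :> R by rewrite pnatr_eq0.
apply/(mulIf (nz n))/(mulIf (nz k)); rewrite mulfVK // mulrAC mulfVK //.
by rewrite -!natrM mulnC -mul_bin_diag /= mulnC.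
Qed.

(** The usual induction for the binomial formula. [harm_pascal] covers the
    indices k > 0; at k = 0 the sum has [Q_(n+1) = Q_n - D_(n+1)] where
    the binomial formula calls for [Q_n], whence the last term. *)
Lemma binomial_harm_poly (R : realType) (x y : R) n :
  \sum_(0 <= k < n.+2) (x ^+ k * y ^+ (n.+1 - k) * 'C(n.+1, k)%:R) *:
      harm_poly R k n.+1 =
  (x + y) *: (\sum_(0 <= k < n.+1) (x ^+ k * y ^+ (n - k) * 'C(n, k)%:R) *:
      harm_poly R k n) - y ^+ n.+1 *: stirling_term R n.+1.
Proof.
rewrite big_nat_recl // subn0 bin0 expr0 mul1r mulr1 harm_poly_sub.
rewrite scalerBr addrAC; congr (_ - _).
under eq_big_nat => k /andP[_ le_kn].
  rewrite subSS -scalerA harm_pascal // scalerDr !scalerA; over.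
rewrite big_split /= addrA scalerDl addrC; congr (_ + _).
  by rewrite scaler_sumr; apply: eq_bigr => k _; rewrite scalerA exprS !mulrA.
rewrite big_nat_recr //= bin_small // mulr0 scale0r addr0.
rewrite big_nat_recl // subn0 bin0 scalerDr scalerA mulr1 expr0 mul1r exprS.
congr (_ + _); rewrite scaler_sumr; apply: eq_big_nat => k /andP[_ lt_kn].
rewrite scalerA; congr (_ *: _).
by rewrite -(subnSK lt_kn) [y ^+ _.+1]exprS; ring.
Qed.

(** The recurrence unrolls to [(x + y)^n (1 - \sum_j mu^j D_j)] with
    [mu = y / (x + y)]; writing 1 as [Q_n + \sum_j D_j] isolates [Q_n], whose
    quotient by itself is constant. *)
Lemma binomial_harm_polyE (R : realType) (x y : R) n : x + y != 0 ->
  \sum_(0 <= k < n.+1) (x ^+ k * y ^+ (n - k) * 'C(n, k)%:R) *: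
      harm_poly R k n =
  (x + y) ^+ n *: (harm_poly R 0 n +
    \sum_(1 <= j < n.+1) (1 - (y / (x + y)) ^+ j) *: stirling_term R j).
Proof.
move=> nz_xy.
under [in RHS]eq_bigr do rewrite scalerBl scale1r.
rewrite sumrB sum_stirling_term addrA [_ + (1 - _)]addrC subrK.
elim: n => [|n IHn].
  by rewrite big_nat1 big_geq // !expr0 !mul1r subr0 harm_poly_id.
rewrite binomial_harm_poly IHn scalerA -exprS [in RHS]big_nat_recr //=.
rewrite opprD addrA [in RHS]scalerBr scalerA; congr (_ - _ *: _).
by rewrite expr_div_n mulrC divfK // expf_neq0.
Qed.

Theorem theorem1p1 (R : realType) (x y : R) (n p : nat)
    (hxy : x + y != 0) (hx : 0 <= x / (x + y)) (hn : (0 < n)%N) (hp : (0 < p)%N) :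
  \sum_(0 <= k < n.+1) x ^+ k * y ^+ (n - k) * 'C(n, k)%:R * bell_number R p k =
  (-1) ^+ (p - 1) * p`!%:R * (x + y) ^+ n *
    \sum_(1 <= j < n.+1) (1 - (y / (x + y)) ^+ j) *
      \sum_(0 <= i < p) (-1) ^+ i * (bell_number R i n / i`!%:R) *
        (stirling1 R j (p - i) / j`!%:R).
Proof.
have fp : p`!%:R != 0 :> R by rewrite pnatr_eq0 -lt0n fact_gt0.
transitivity (p`!%:R * inv_coef n p (\sum_(0 <= k < n.+1)
    (x ^+ k * y ^+ (n - k) * 'C(n, k)%:R) *: harm_poly R k n)).
  rewrite inv_coef_sum mulr_sumr; apply: eq_big_nat => k /andP[_ le_kn].
  by rewrite inv_coef_tail // mulrCA [_ * nbell _ _ _]mulrC divfK.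
rewrite binomial_harm_polyE // inv_coefZ inv_coefD inv_coef_tail // nbell_at0.
rewrite eqn0Ngt hp add0r inv_coef_sum.
rewrite -!mulrA [RHS]mulrCA; congr (_ * _); rewrite [RHS]mulrCA; congr (_ * _).
rewrite mulr_sumr; apply: eq_big_nat => j /andP[j_gt0 _]; rewrite [RHS]mulrCA.
congr (_ * _); rewrite /inv_coef big_ord_recr /= subnn coef0_stirling_term.
rewrite mulr0 addr0 big_mkord mulr_sumr; apply: eq_bigr => i _.
rewrite coef_stirling_term ?subn_gt0 // -/(nbell R i n).
have le_ip : (i <= p - 1)%N by rewrite subn1 -ltnS prednK.
have -> : (-1) ^+ (p - i - 1) = (-1) ^+ (p - 1) * (-1) ^+ i :> R.
  by rewrite subnAC -[in RHS](subnK le_ip) exprD -mulrA -expr2 sqrr_sign mulr1.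
by ring.
Qed.
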